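(* Let $S,T$ be two $n$-SLTM with $S\nsim 0_n$ and $T\nsim 0_n$, such that both are in the second reduced echelon form ($2$-REF) and $\mathbb{W}(S)=\mathbb{W}(T)=(r_1,\dots,r_h)$. If $S\sim T$, then $\mathbb{M}(S)=\mathbb{M}(T)$.
   Context: Let $\mathbb{F}$ be a field of characteristic different from $2$. An $n$-SLTM is a strictly lower triangular $n\times n$ matrix with entries in $\mathbb{F}$; $0_n$ is the zero matrix. For an $n$-SLTM $T=[t_{ij}]$, $\mathcal{A}(T)$ is the commutative unital $\mathbb{F}$-algebra with generators $X_1,\dots,X_n$ and relations $X_1^2=0$ and $X_i^2=\sum_{j<i}t_{ij}X_jX_i$ for $2\le i\le n$, graded by $\deg(X_i)=2$. For two $n$-SLTM $T,S$, write $T\sim S$ if there is a degree-preserving isomorphism of $\mathbb{F}$-algebras $\mathcal{A}(T)\to\mathcal{A}(S)$; this is an equivalence relation. Intervals are intervals of integers: $[a,b]=\{m:a\le m\le b\}$, $[a,b[=\{m:a\le m<b\}$, $]a,b]=\{m:a<m\le b\}$, $]a,b[=\{m:a<m<b\}$. For an $n$-SLTM $T$, $T^{[r]}$ is its $r$-th row, and $T^{I}_{J}$ is the submatrix of entries $t_{ij}$ with $i\in I$, $j\in J$; $T^{[r]}_J$ is the case $I=\{r\}$. For a matrix $M$, $\mu(M)$ is the number of nonzero entries of $M$. For $r\in[1,n]$ let $c_r=\max\{j:t_{rj}\ne 0\}$ if $T^{[r]}\neq 0$ and $c_r=0$ otherwise. If $c_r>0$, $t_{r,c_r}$ is the leader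 of the $r$-th row and $(r,c_r)$ is its leader position. For $\alpha\in\mathbb{F}$ and $1\le i<j<k\le n$ put $\Delta^{(\alpha)}_{i,j,k}(T)=\alpha t_{ki}+t_{kj}t_{ji}$. First reduced echelon form ($1$-REF): an $n$-SLTM $S\ne 0_n$ is in $1$-REF if (1) all zero rows of $S$ are above all nonzero rows; (2) for each leader position $(r,c)$ we have $c>1$ and there is $i_0\in[1,c[$ with $\Delta^{(2)}_{i_0,c,r}(S)\neq 0$; (3) if $(r,c_r)$ and $(r+1,c_{r+1})$ are leader positions of rows $r$ and $r+1$, then $c_r\le c_{r+1}$. The zero matrix is also in $1$-REF. Wall: for $S\neq 0_n$ in $1$-REF define recursively $r_1=\min\{r\in[1,n]:S^{[r]}\ne 0\}$ and, given $r_j$, let $A_j=\{r\in\,]r_j,n]: c_r\ge r_j\}$; if $A_j\neq\emptyset$ put $r_{j+1}=\min(A_j)$; if $A_j=\emptyset$ stop and put $\mathbb{W}(S)=(r_1,\dots,r_j)$. Also $\mathbb{W}(0_n)=(0)$. For an arbitrary $n$-SLTM $T$, $\mathbb{W}(T):=\mathbb{W}(S)$ where $S$ is any matrix in $1$-REF with $T\sim S$ (such $S$ exists and the value does not depend on the choice). When $\mathbb{W}(T)=(r_1,\dots,r_h)$ put $r_0=1$ and $r_{h+1}=n+1$. Second reduced echelon form ($2$-REF): an $n$-SLTM $T\nsim 0_n$ with $\mathbb{W}(T)=(r_1,\dots,r_h)$ is in $2$-REF if (1) $T$ has exactly $r_1-1$ zero rows and they are above the nonzero rows; (2) for each leader position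 $(r,c_r)$ we have $c_r>1$ and there is $i_0\in[1,c_r[$ with $\Delta^{(2)}_{i_0,c_r,r}(T)\ne 0$; moreover for each $j\in[1,h]$ and $r\in[r_j,r_{j+1}[$ we have $c_r\in[r_{j-1},r_j[$; (3) for each $j\in[1,h]$ and $r\in[r_j,r_{j+1}-1[$, $\mu(T^{[r]}_{[r_{j-1},r_j[})\le\mu(T^{[r+1]}_{[r_{j-1},r_j[})$. The zero matrix is also said to be in $2$-REF. Measure sequence: let $T\nsim 0_n$ be in $2$-REF with $\mathbb{W}(T)=(r_1,\dots,r_h)$. For each $j\in[1,h]$ put $r_{j1}=r_j$, $\mu_{j1}=\mu(T^{[r_{j1}]}_{[r_{j-1},r_j[})$. Given $r_{jk},\mu_{jk}$, let $A_{jk}=\{r\in\,]r_{jk},r_{j+1}[\;:\;\mu(T^{[r]}_{[r_{j-1},r_j[})>\mu_{jk}\}$; if $A_{jk}\ne\emptyset$ put $r_{j,k+1}=\min(A_{jk})$ and $\mu_{j,k+1}=\mu(T^{[r_{j,k+1}]}_{[r_{j-1},r_j[})$; if $A_{jk}=\emptyset$ stop and let $M_j(T)=\begin{pmatrix} r_{j1}&\cdots&r_{jk}\\ \mu_{j1}&\cdots&\mu_{jk}\end{pmatrix}$. The measure sequence is $\mathbb{M}(T)=(M_1(T),\dots,M_h(T))$. *)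

(* Defs.v *)
From HB Require Import structures.
From mathcomp Require Import all_boot all_order all_algebra.
From mathcomp Require Import generic_quotient ring_quotient.
From mathcomp Require Import mpoly.
From mathcomp Require Import boolp classical_sets.

Set Implicit Arguments.
Unset Strict Implicit.
Unset Printing Implicit Defensive.

Import GRing.Theory.
Local Open Scope ring_scope.
Local Open Scope quotient_scope.

Section Algebra.
Context {F : fieldType} {n : nat}.
Implicit Types T : 'M[F]_n.

Definition is_sltm T : Prop := forall i j : 'I_n, (i <= j)%N -> T i j = 0.

Definition slt_relator T (i : 'I_n) : {mpoly F[n]} :=
  'X_i ^+ 2 - \sum_(j < n | (j < i)%N) T i j *: ('X_j * 'X_i).

Definition slt_ideal T : {pred {mpoly F[n]}} :=
  fun p => `[< exists c : 'I_n -> {mpoly F[n]},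
                 p = \sum_(i < n) c i * slt_relator T i >].

Lemma slt_idealP T p : reflect
  (exists c : 'I_n -> {mpoly F[n]}, p = \sum_(i < n) c i * slt_relator T i)
  (p \in slt_ideal T).
Proof. exact: asboolP. Qed.

Lemma slt_ideal_closed T : idealr_closed (slt_ideal T).
Proof.
split.
- apply/slt_idealP; exists (fun=> 0).
  by rewrite big1 // => i _; rewrite mul0r.
- apply/negP => /slt_idealP[c] /(congr1 (mcoeff 0%MM)).
  rewrite mcoeff1 eqxx raddf_sum big1 => [/eqP|i _]; first by rewrite oner_eq0.
  have comul (p q : {mpoly F[n]}) : (p * q)@_0 = p@_0 * q@_0.
    exact: (rmorphM (mcoeff 0%MM)).
  have X0 k : ('X_k : {mpoly F[n]})@_0 = 0 by rewrite mcoeffX mnm1_eq0.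
  rewrite /= comul mcoeffB raddf_sum big1 => [|j _ /=].
    by rewrite expr2 comul X0 mul0r subr0 mulr0.
  by rewrite mcoeffZ comul X0 mul0r mulr0.
- move=> a u v /slt_idealP[c ->] /slt_idealP[d ->]; apply/slt_idealP.
  exists (fun i => a * c i + d i); rewrite mulr_sumr -big_split /=.
  by apply: eq_bigr => i _; rewrite mulrDl mulrA.
Qed.

HB.instance Definition _ T :=
  isIdealr.Build {mpoly F[n]} (slt_ideal T) (slt_ideal_closed T).

Definition slt_alg T : Type := {ideal_quot (slt_ideal T)}.

HB.instance Definition _ T := GRing.ComNzRing.on (slt_alg T).

Definition slt_pi T (p : {mpoly F[n]}) : slt_alg T :=
  \pi_{ideal_quot (slt_ideal T)} p.

Fact slt_pi_is_zmod T : zmod_morphism (slt_pi T).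
Proof. exact: (raddfB \pi_{ideal_quot (slt_ideal T)}). Qed.
Fact slt_pi_is_monoid T : monoid_morphism (slt_pi T).
Proof.
split; first exact: (rmorph1 \pi_{ideal_quot (slt_ideal T)}).
exact: (rmorphM \pi_{ideal_quot (slt_ideal T)}).
Qed.
HB.instance Definition _ T :=
  GRing.isZmodMorphism.Build _ _ (slt_pi T) (slt_pi_is_zmod T).
HB.instance Definition _ T :=
  GRing.isMonoidMorphism.Build _ _ (slt_pi T) (slt_pi_is_monoid T).

Definition slt_scale T (a : F) (x : slt_alg T) : slt_alg T :=
  slt_pi T a%:MP * x.

Fact slt_scaleA T a b x :
  @slt_scale T a (slt_scale b x) = slt_scale (a * b) x.
Proof. by rewrite /slt_scale mpolyCM rmorphM mulrA. Qed.
Fact slt_scale1 T : left_id 1 (@slt_scale T).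
Proof. by move=> x; rewrite /slt_scale rmorph1 mul1r. Qed.
Fact slt_scaleDr T : right_distributive (@slt_scale T) +%R.
Proof. by move=> a x y; rewrite /slt_scale mulrDr. Qed.
Fact slt_scaleDl T x : {morph (@slt_scale T)^~ x : a b / a + b}.
Proof. by move=> a b; rewrite /slt_scale mpolyCD raddfD mulrDl. Qed.
HB.instance Definition _ T := GRing.Zmodule_isLmodule.Build F (slt_alg T)
  (@slt_scaleA T) (@slt_scale1 T) (@slt_scaleDr T) (@slt_scaleDl T).

Fact slt_scaleAl T (a : F) (x y : slt_alg T) : a *: (x * y) = (a *: x) * y.
Proof. exact: mulrA. Qed.
HB.instance Definition _ T :=
  GRing.Lmodule_isLalgebra.Build F (slt_alg T) (@slt_scaleAl T).
Fact slt_scaleAr T (a : F) (x y : slt_alg T) : a *: (x * y) = x * (a *: y).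
Proof. exact: mulrCA. Qed.
HB.instance Definition _ T :=
  GRing.Lalgebra_isAlgebra.Build F (slt_alg T) (@slt_scaleAr T).

(* x is the class of a polynomial whose monomials all have degree d, where
   deg X_i = 2. *)
Definition slt_homog T (d : nat) (x : slt_alg T) : Prop :=
  exists2 p : {mpoly F[n]},
    {in msupp p, forall m, (mdeg m).*2 = d} & x = slt_pi T p.

Definition slt_sim T S : Prop :=
  exists2 f : {lrmorphism slt_alg T -> slt_alg S},
    bijective f & forall d x, slt_homog d x -> slt_homog d (f x).

End Algebra.

Local Open Scope nat_scope.

Section EchelonForms.
Context {F : fieldType} {n : nat}.
Implicit Types (T S : 'M[F]_n) (r c i j k : nat).

(* The entry t_ij with 1-based indices; it is 0 unless 1 <= i, j <= n. *)
Definition entry T i j : F :=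
  (\sum_(a < n | a.+1 == i) \sum_(b < n | b.+1 == j) T a b)%R.

Definition nonzero_row T r : bool :=
  has (fun j => entry T r j != 0%R) (index_iota 1 n.+1).

(* c_r, with value 0 on a zero row. *)
Definition leader_col T r : nat :=
  \max_(1 <= j < n.+1 | entry T r j != 0%R) j.

Definition leader_pos T r c : Prop :=
  [/\ 1 <= r <= n, 0 < c & leader_col T r = c].

(* mu of the part of row r with columns in [a, b[. *)
Definition row_mu T (a b r : nat) : nat :=
  count (fun j => entry T r j != 0%R) (index_iota a b).

Definition Delta T (alpha : F) i j k : F :=
  (alpha * entry T k i + entry T k j * entry T j i)%R.

Definition zero_rows_on_top T : Prop :=
  forall r s, 1 <= r <= n -> 1 <= s <= n ->
    ~~ nonzero_row T r -> nonzero_row T s -> r < s.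

Definition leader_Delta T : Prop :=
  forall r c, leader_pos T r c ->
    1 < c /\ exists2 i0, 1 <= i0 < c & Delta T 2%:R i0 c r != 0%R.

Definition is_1REF S : Prop :=
  S = 0%R \/
  [/\ is_sltm S, S <> 0%R, zero_rows_on_top S, leader_Delta S &
      forall r c c', leader_pos S r c -> leader_pos S r.+1 c' -> c <= c'].

(* Along the increasing list s of the integers in ]r, b[, the successive minima
   r' = min {q in ]r, b[ | P r q}, r'' = min {q in ]r', b[ | P r' q}, ... *)
Fixpoint min_chain (P : rel nat) r (s : seq nat) : seq nat :=
  if s is q :: s' then
    if P r q then q :: min_chain P q s' else min_chain P r s'
  else [::].

Definition chain_from (P : rel nat) r b : seq nat :=
  r :: min_chain P r (index_iota r.+1 b).

Definition wall_1REF S : seq nat :=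
  if [seq r <- index_iota 1 n.+1 | nonzero_row S r] is r1 :: _ then
    chain_from (fun rj r => rj <= leader_col S r) r1 n.+1
  else [:: 0].

(* xget picks some 1-REF matrix S with T ~ S (0 if there were none); the value
   of wall_1REF does not depend on the choice. *)
Definition wall T : seq nat :=
  wall_1REF (xget 0%R [set S | is_1REF S /\ slt_sim T S]%classic).

(* r_j, including the conventions r_0 = 1 and r_{h+1} = n + 1. *)
Definition wall_nth (w : seq nat) j : nat := nth n.+1 (1 :: w) j.

Definition is_2REF T : Prop :=
  T = 0%R \/
  let w := wall T in let h := size w in let rr := wall_nth w in
  [/\ is_sltm T /\ ~ slt_sim T 0%R,
      (count (fun r => ~~ nonzero_row T r) (index_iota 1 n.+1)).+1 = rr 1
        /\ zero_rows_on_top T,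
      leader_Delta T
        /\ (forall j r, 1 <= j <= h -> rr j <= r < rr j.+1 ->
              rr j.-1 <= leader_col T r < rr j) &
      forall j r, 1 <= j <= h -> rr j <= r -> r.+1 < rr j.+1 ->
        row_mu T (rr j.-1) (rr j) r <= row_mu T (rr j.-1) (rr j) r.+1].

(* M_j(T), read column by column: the list of the pairs (r_{jk}, mu_{jk}). *)
Definition measure_block T j : seq (nat * nat) :=
  let rr := wall_nth (wall T) in
  let mu := row_mu T (rr j.-1) (rr j) in
  [seq (r, mu r) | r <- chain_from (fun r q => mu r < mu q) (rr j) (rr j.+1)].

Definition measure_seq T : seq (seq (nat * nat)) :=
  [seq measure_block T j | j <- iota 1 (size (wall T))].

End EchelonForms.

(* Main.v *)
Require Import Defs.
From mathcomp Require Import all_boot all_order all_algebra.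
From mathcomp Require Import mpoly.
From mathcomp Require Import generic_quotient ring_quotient.
From mathcomp Require Import ring.

(* Write V_j for the span of the X_i with i < r_{j+1} (in A(T), and likewise in
   A(S)), and L_r = sum_i t_ri X_i, so that X_r^2 = L_r X_r. If v has leading
   term X_s and v^2 = b v with b in V_{j-1}, then b = L_s + 2u for v = X_s + u,
   and b^2 = L_s^2. The condition on Delta says that L_s^2 has a nonzero
   coefficient at some X_i X_c with c in the block just below that of s, so s
   cannot lie above block j. Applied to the images of the generators, this shows
   that a graded isomorphism preserves every V_j and acts on V_j / V_{j-1} by a
   permutation sigma of the generators, up to scalars. Modulo V_{j-2}, b^2 = L_s^2
   says that b and L_s have the same products of pairs of distinct coefficients,
   hence supports of the same size. So sigma transports the numbers
   mu(S^[r]) of each block to those of T, and both are listed increasingly. *)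

Set Implicit Arguments.
Unset Strict Implicit.
Unset Printing Implicit Defensive.

(** * Linear and quadratic coordinates in [slt_alg T], and the matrix of a graded isomorphism *)

Section DegreeTwo.
Import GRing.Theory.
Local Open Scope ring_scope.
Context {F : fieldType} {n : nat}.
Implicit Types (T S P : 'M[F]_n) (a b c d : 'I_n -> F) (i j k r : 'I_n).

Definition linform a : {mpoly F[n]} := \sum_(i < n) a i *: 'X_i.

(** Replacing every [X_k ^ 2] by its relation turns a quadratic form into a combination of
    square-free monomials; for [i < k] this is the resulting coefficient of [X_i X_k]. *)
Definition normal_coef T i k (p : {mpoly F[n]}) : F :=
  p@_(U_(i) + U_(k))%MM + T k i * p@_(U_(k) + U_(k))%MM.

Lemma mnm2_eq i j k l :
  ((U_(i) + U_(j))%MM == (U_(k) + U_(l))%MM :> 'X_{1..n})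
  = ((i == k) && (j == l)) || ((i == l) && (j == k)).
Proof.
apply/eqP/orP => [E|[] /andP[/eqP -> /eqP ->] //]; last exact: addmC.
have U_inj (x y : 'I_n) : U_(x)%MM = U_(y)%MM -> x = y.
  by move/eqP; rewrite eq_mnm1 => /eqP.
case: (eqVneq i k) E => [<- /addmI/U_inj ->|ik E]; first by left; rewrite !eqxx.
have /mnmP/(_ i) := E; rewrite !mnmDE !mnm1E eqxx [k == i]eq_sym (negPf ik) add0n.
case: (eqVneq l i) E => [-> E _|]; last by [].
by move: E; rewrite [RHS]addmC => /addmI/U_inj ->; right; rewrite !eqxx.
Qed.

Lemma slt_piE T p q : (slt_pi T p == slt_pi T q) = (p - q \in slt_ideal T).
Proof. by rewrite /slt_pi -Quotient.idealrBE. Qed.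

Lemma mcoeff_linform a k : (linform a)@_U_(k) = a k.
Proof.
rewrite raddf_sum (bigD1 k) //= big1 => [|i ik];
by rewrite mcoeffZ mcoeffXU ?eqxx ?mulr1 ?addr0 // (negPf ik) mulr0.
Qed.

Lemma linform_dhomog a : linform a \is 1.-homog.
Proof. by apply: rpred_sum => i _; rewrite dhomogZ // dhomogX /= mdeg1. Qed.

Lemma mcoeff_linformM a b i k :
  (linform a * linform b)@_(U_(i) + U_(k))%MM
  = if i == k then a i * b i else a i * b k + a k * b i.
Proof.
have coefE (x y : 'I_n) : ((a x *: 'X_x) * (b y *: 'X_y) : {mpoly F[n]})@_(U_(i) + U_(k))
   = a x * b y * (((x == i) && (y == k)) || ((x == k) && (y == i)))%:R.
  by rewrite -scalerAl -scalerAr scalerA mcoeffZ -mpolyXD mcoeffX mnm2_eq.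
rewrite /linform big_distrlr raddf_sum /=.
under eq_bigr => x _ do [rewrite raddf_sum /=; under eq_bigr => y _ do rewrite coefE].
rewrite (bigD1 i) //= (bigD1 k) //= !eqxx /= mulr1.
rewrite [X in _ + X + _]big1 => [|y /negPf yk]; last first.
  rewrite yk /=; case: (eqVneq i k) yk => [->|_ _]; first by move=> ->; rewrite mulr0.
  by rewrite mulr0.
rewrite addr0; case: (eqVneq i k) => [->|ik].
  rewrite big1 ?addr0 // => x /negPf xi; rewrite big1 // => y _.
  by rewrite xi mulr0.
rewrite (bigD1 k) 1?eq_sym //= (bigD1 i) //= !eqxx (negPf ik) /= mulr1.
rewrite big1 => [|y /negPf yi]; last by rewrite yi mulr0.
rewrite big1 ?addr0 // => x /andP[/negPf xi /negPf xk].
by rewrite big1 // => y _; rewrite xi xk mulr0.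
Qed.

Lemma relator_dhomog T i : slt_relator T i \is 2.-homog.
Proof.
rewrite /slt_relator rpredB //; last apply: rpred_sum => j _.
  by rewrite expr2 -mpolyXD dhomogX /= mdegD !mdeg1.
by rewrite dhomogZ // -mpolyXD dhomogX /= mdegD !mdeg1.
Qed.

(** A nonconstant monomial of [p] pushes [q] into degrees above [d], so only the constant term of
    [p] contributes. *)
Lemma mcoeffM_dhomog (d : nat) (m : 'X_{1..n}) (p q : {mpoly F[n]}) :
  q \is d.-homog -> (mdeg m <= d)%N -> (p * q)@_m = p@_0%MM * q@_m.
Proof.
move=> qd md; rewrite [p in LHS]mpolyE mulr_suml [LHS]raddf_sum /=.
rewrite [p in RHS]mpolyE raddf_sum /= mulr_suml; apply: eq_bigr => m' _.
rewrite -scalerAl !mcoeffZ -mulrA mcoeffX; congr (_ * _).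
case: eqVneq => [->|m'0]; first by rewrite mpolyX0 !mul1r.
have m'_homog : ('X_[m'] : {mpoly F[n]}) \is (mdeg m').-homog by rewrite dhomogX.
rewrite mul0r; apply: (dhomog_nemf_coeff (dhomogM m'_homog qd)); rewrite /=.
by rewrite neq_ltn (leq_ltn_trans md) // -[X in (X < _)%N]add0n ltn_add2r lt0n mdeg_eq0.
Qed.

(** Up to polynomial degree 2 the ideal is just the [F]-span of the relators, as these are
    homogeneous of degree 2. *)
Lemma slt_ideal_mcoeff T p : p \in slt_ideal T ->
  exists c : 'I_n -> F,
    forall m, (mdeg m <= 2)%N -> p@_m = \sum_(i < n) c i * (slt_relator T i)@_m.
Proof.
case/slt_idealP => c ->; exists (fun i => (c i)@_0%MM) => m m2.
rewrite raddf_sum /=; apply: eq_bigr => i _.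
exact: mcoeffM_dhomog (relator_dhomog T i) m2.
Qed.

Lemma slt_ideal_mcoeff1 T p i : p \in slt_ideal T -> p@_U_(i) = 0.
Proof.
case/slt_ideal_mcoeff => c ->; last by rewrite mdeg1.
rewrite big1 // => k _; rewrite (dhomog_nemf_coeff (relator_dhomog T k)) ?mulr0 //.
by rewrite /= mdeg1.
Qed.

(** All monomials of relator [r] are [X_j X_r] with [j <= r], so [r] has to be the larger index
    [k]. *)
Lemma mcoeff_relator T r i k : (i <= k)%N ->
  (slt_relator T r)@_(U_(i) + U_(k)) = (r == k)%:R * ((i == k)%:R - (i < k)%:R * T k i).
Proof.
move=> ik; rewrite mcoeffB expr2 -mpolyXD mcoeffX mnm2_eq raddf_sum /=.
under eq_bigr => j jr do rewrite mcoeffZ -mpolyXD mcoeffX mnm2_eq.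
case: (eqVneq r k) => [->|rk] /=; last first.
  rewrite mul0r andbF big1 ?subr0 // => j jr.
  case: (eqVneq r i) jr => [->|_ _]; last by rewrite !andbF mulr0.
  by case: (eqVneq j k) => [->|_ _]; [rewrite ltnNge ik|rewrite andbF mulr0].
rewrite mul1r andbT orbb [k == i]eq_sym; congr (_ - _).
case: (ltnP i k) => [lik|]; last first.
  move=> ki; rewrite mul0r big1 // => j jk.
  have -> : i = k by apply/val_inj/anti_leq; rewrite ik.
  have /negPf -> : j != k by apply: contraTneq jk => ->; rewrite ltnn.
  by rewrite mulr0.
rewrite mul1r (bigD1 i) //= !eqxx mulr1 big1 ?addr0 // => j /andP[jk ji].
rewrite (negPf ji) /=.
by rewrite -(val_eqE i) (ltn_eqF lik) andbF mulr0.
Qed.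

Lemma normal_coef_ideal T p i k : (i < k)%N -> p \in slt_ideal T ->
  normal_coef T i k p = 0.
Proof.
move=> ik /slt_ideal_mcoeff[c cE]; rewrite /normal_coef.
rewrite !cE ?mdegD ?mdeg1 // mulr_sumr -big_split big1 //= => r _.
rewrite !mcoeff_relator ?leqnn ?(ltnW ik) // ltnn eqxx ik -(val_eqE i) (ltn_eqF ik) /=.
by ring.
Qed.

Lemma slt_pi_linform_inj T a b :
  slt_pi T (linform a) = slt_pi T (linform b) -> a =1 b.
Proof.
move/eqP; rewrite slt_piE => /slt_ideal_mcoeff1 ab i.
by apply/eqP; rewrite -subr_eq0 -!mcoeff_linform -mcoeffB ab.
Qed.

Lemma slt_pi_linformM T a b c d i k : (i < k)%N ->
  slt_pi T (linform a) * slt_pi T (linform b)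
    = slt_pi T (linform c) * slt_pi T (linform d) ->
  a i * b k + a k * b i + T k i * (a k * b k)
    = c i * d k + c k * d i + T k i * (c k * d k).
Proof.
move=> ik /eqP; rewrite -!rmorphM slt_piE => /(normal_coef_ideal ik) /eqP.
rewrite /normal_coef !mcoeffB !mcoeff_linformM eqxx -(val_eqE i) (ltn_eqF ik) /= => E.
by apply/eqP; rewrite -subr_eq0; apply: etrans E; congr (_ == _); ring.
Qed.

Lemma slt_pi_linform T a :
  slt_pi T (linform a) = \sum_(i < n) a i *: slt_pi T 'X_i.
Proof.
rewrite raddf_sum /=; apply: eq_bigr => i _.
by rewrite -mul_mpolyC rmorphM.
Qed.

Lemma slt_relation T r : is_sltm T ->
  slt_pi T 'X_r * slt_pi T 'X_r = slt_pi T (linform (T r)) * slt_pi T 'X_r.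
Proof.
move=> sltT; apply/eqP; rewrite -!rmorphM slt_piE; apply/slt_idealP.
(* The difference is the relator of [r] itself; strict triangularity extends its sum from [j < r] to
   all [j]. *)
exists (fun i => (i == r)%:R); rewrite (bigD1 r) //= big1 => [|i /negPf ->]; last first.
  by rewrite mul0r.
rewrite eqxx mul1r addr0 /slt_relator expr2; congr (_ - _).
rewrite /linform mulr_suml [RHS]big_mkcond /=; apply: eq_bigr => j _.
case: ltnP => [_|/sltT ->]; first by rewrite -scalerAl.
by rewrite scale0r mul0r.
Qed.

Lemma linform_delta r : linform ((delta_mx 0 r : 'rV[F]_n) 0) = 'X_r.
Proof.
rewrite /linform (bigD1 r) //= big1 => [|i /negPf ir]; rewrite !mxE ?eqxx ?ir ?scale0r //.
by rewrite scale1r addr0.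
Qed.

Lemma slt_homog2 T (x : slt_alg T) : slt_homog 2 x -> exists a, x = slt_pi T (linform a).
Proof.
case=> p p1 ->; exists (fun i => p@_U_(i)); congr (slt_pi T _).
apply/mpolyP => m; case: (eqVneq (mdeg m) 1%N) => [/eqP/mdeg1P[i /eqP ->]|m1].
  by rewrite mcoeff_linform.
rewrite (dhomog_nemf_coeff (linform_dhomog _)) //; apply/eqP.
by apply: contraR m1; rewrite mcoeff_eq0 negbK => /p1 /(congr1 half); rewrite doubleK => ->.
Qed.

(* With a the r-th row of P and b the r-th row of S *m P, this is the equality
   of the X_i X_k coordinates of a^2 = b a in the algebra of T. *)
Definition compatible S T P := forall r i k, (i < k)%N ->
  let a := P r in let b := (S *m P) r in
  a i * a k + a k * a i + T k i * (a k * a k)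
    = a i * b k + a k * b i + T k i * (a k * b k).

Lemma slt_pi_compatible S T P :
  (forall r, let x := slt_pi T (linform (P r)) in
     x * x = slt_pi T (linform ((S *m P) r)) * x) -> compatible S T P.
Proof.
move=> relP r i k ik /=.
by rewrite (slt_pi_linformM ik (relP r)); ring.
Qed.

(** The rows of [P] are the coordinates of the images of the generators, and [Q] is the inverse of
    [P]. Applying the injective [f] to the relations required of [Q] turns them into the defining
    relations of [T]. *)
Lemma slt_sim_compatible S T : is_sltm S -> is_sltm T -> slt_sim S T ->
  exists P, exists2 Q, [/\ P *m Q = 1%:M & Q *m P = 1%:M] &
    compatible S T P /\ compatible T S Q.
Proof.
move=> sltS sltT [f /bij_inj f_inj f_homog].
have /fin_all_exists [g gE] (r : 'I_n) : exists a : {ffun 'I_n -> F},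
    f (slt_pi S 'X_r) = slt_pi T (linform a).
  have /f_homog/slt_homog2[a ->] : slt_homog 2 (slt_pi S 'X_r).
    by exists 'X_r => // m; rewrite msuppX inE => /eqP ->; rewrite mdeg1.
  exists (finfun a); congr (slt_pi T _).
  by apply: eq_bigr => i _; rewrite ffunE.
pose P : 'M[F]_n := \matrix_(r, k) g r k.
have fX r : f (slt_pi S 'X_r) = slt_pi T (linform (P r)).
  by rewrite gE; congr (slt_pi T _); apply: eq_bigr => i _; rewrite mxE.
have fL (u : 'rV[F]_n) : f (slt_pi S (linform (u 0))) = slt_pi T (linform ((u *m P) 0)).
  rewrite !slt_pi_linform linear_sum /=.
  under eq_bigr => i _ do rewrite linearZ /= fX slt_pi_linform scaler_sumr.
  rewrite exchange_big; apply: eq_bigr => k _ /=; rewrite mxE scaler_suml.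
  by apply: eq_bigr => i _; rewrite scalerA.
have fR (M : 'M[F]_n) r : f (slt_pi S (linform (M r))) = slt_pi T (linform ((M *m P) r)).
  have rowE (N : 'M[F]_n) : linform (N r) = linform (row r N 0).
    by apply: eq_bigr => i _; rewrite mxE.
  by rewrite !rowE fL row_mul.
(* A row vector killed by [P] gives a linear form killed by [f], and linear forms embed in the
   algebra because the ideal has no part in degree 1. *)
have P_unit : P \in unitmx.
  rewrite -row_free_unit; apply: inj_row_free => u uP0.
  have /slt_pi_linform_inj u0 : slt_pi S (linform (u 0)) = slt_pi S (linform ((0 : 'rV_n) 0)).
    by apply: f_inj; rewrite !fL uP0 mul0mx.
  by apply/rowP => i; rewrite u0.
have X1 M r : slt_pi M 'X_r = slt_pi M (linform ((1%:M : 'M[F]_n) r)).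
  rewrite -linform_delta; congr (slt_pi _ _).
  by apply: eq_bigr => i _; rewrite !mxE eqxx eq_sym.
exists P, (invmx P); first by rewrite mulmxV ?mulVmx.
split; apply: slt_pi_compatible => r /=.
  by rewrite -fX -fR -[LHS]rmorphM -[RHS]rmorphM /= slt_relation.
apply: f_inj; rewrite !rmorphM /= !fR -mulmxA mulVmx // mulmx1 -X1.
exact: slt_relation.
Qed.

Lemma slt_sim_refl T : slt_sim T T.
Proof. by exists idfun => //; exists idfun. Qed.

End DegreeTwo.

(** * Block structure of compatible matrices, for an abstract level function *)

Section Levels.
Import GRing.Theory.
Local Open Scope ring_scope.
Context {F : fieldType} {n : nat} (lev : 'I_n -> nat).
Hypothesis charF : 2%N \notin [pchar F].
Implicit Types (S T P Q : 'M[F]_n) (i j k r s : 'I_n).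

(** What the argument extracts from 2-REF, with [lev i] standing for the block of row [i] and 0 for
    the rows above the first block. The last clause is the nonvanishing of Delta with parameter 2,
    where [c] will be the leader column. *)
Definition leveled T :=
  [/\ forall i k, (i <= k)%N -> (lev i <= lev k)%N,
      forall i k, T i k != 0 -> (lev k < lev i)%N &
      forall i, (0 < lev i)%N -> exists c : 'I_n, exists2 i0 : 'I_n, (i0 < c)%N &
        [/\ (lev c).+1 = lev i, T i c != 0 & 2%:R * T i i0 + T i c * T c i0 != 0]].

Lemma natr2_neq0 : 2%:R != 0 :> F.
Proof. by move: charF; rewrite inE. Qed.

(* If L = sum_k T_sk X_k then (X_s + u)^2 = b (X_s + u) forces b = L + 2u,
   hence b^2 = L^2; here s is the largest index in the support of a. *)
Lemma square_multiple_level T (m : nat) (a b : 'I_n -> F) : leveled T ->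
  (forall k, (m <= lev k)%N -> b k = 0) ->
  (forall i k, (i < k)%N ->
     a i * a k + a k * a i + T k i * (a k * a k)
       = a i * b k + a k * b i + T k i * (a k * b k)) ->
  (forall k, (m <= lev k)%N -> a k = 0) \/
  exists s, [/\ lev s = m, a s != 0,
    forall k, (m <= lev k)%N -> k != s -> a k = 0 &
    forall i k, (i < k)%N -> (lev k < m)%N ->
      2%:R * (b i * b k) + T k i * b k ^+ 2
        = a s ^+ 2 * (2%:R * (T s i * T s k) + T k i * T s k ^+ 2)].
Proof.
move=> [lev_homo levT levD] b0 E.
have [/existsP[k0 ak0]|/existsPn a0] := boolP [exists k, a k != 0]; last first.
  by left => k _; apply/eqP; rewrite -[_ == _]negbK a0.
have [s as0 s_max] := @arg_maxnP _ k0 (fun k => a k != 0) (fun k : 'I_n => val k) ak0.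
have a_gt k : (s < k)%N -> a k = 0.
  by move=> sk; apply/eqP; apply: contraTT sk => /s_max /=; rewrite -leqNgt.
have [lev_s|lev_s] := ltnP (lev s) m.
  left=> k mk; apply/a_gt; rewrite ltnNge; apply: contraTN (leq_trans lev_s mk).
  by move/lev_homo; rewrite -leqNgt.
(* This is the [X_i X_s] coordinate, where [b s = 0], divided by [a s]. *)
have aE i : (i < s)%N -> 2%:R * a i = b i - a s * T s i.
  move=> /E; rewrite (b0 s) // !mulr0 addr0 add0r => Eis.
  apply: (mulfI as0); rewrite mulrBr -Eis; ring.
have bE i k : (i < k)%N -> (k < s)%N -> 2%:R * (b i * b k) + T k i * b k ^+ 2
        = a s ^+ 2 * (2%:R * (T s i * T s k) + T k i * T s k ^+ 2).
  move=> ik ks; have is_ := ltn_trans ik ks.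
  (* The factor 4 lets [aE] eliminate [2 a_i] and [2 a_k] without halves. *)
  have := E i k ik => /(congr1 (fun x => 2%:R * (2%:R * x))).
  have -> : 2%:R * (2%:R * (a i * a k + a k * a i + T k i * (a k * a k)))
     = 2%:R * ((2%:R * a i) * (2%:R * a k)) + T k i * ((2%:R * a k) * (2%:R * a k)) by ring.
  have -> : 2%:R * (2%:R * (a i * b k + a k * b i + T k i * (a k * b k)))
     = 2%:R * ((2%:R * a i) * b k + (2%:R * a k) * b i + T k i * ((2%:R * a k) * b k)) by ring.
  rewrite !aE // => /eqP; rewrite -subr_eq0 => /eqP Eik.
  by apply/eqP; rewrite -subr_eq0 -oppr_eq0; apply/eqP; rewrite -[RHS]Eik; ring.
have lt_s k : (lev k < lev s)%N -> (k < s)%N.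
  by move=> ks; rewrite ltnNge; apply: contraTN ks => /lev_homo; rewrite -leqNgt.
(* If [s] were above level [m], then [c], one level below [s], would satisfy [b c = 0]. The
   [X_i0 X_c] coordinate of [b^2] would vanish, while that of [L^2] is [T s c] times a nonzero
   Delta. *)
have lev_sE : lev s = m.
  apply/eqP; rewrite eqn_leq lev_s andbT; case: (posnP (lev s)) => [->//|/levD].
  move=> [c [i0 i0c [<- Tsc Delta]]]; rewrite ltnNge; apply/negP => /b0 bc.
  have := bE i0 c i0c (lt_s _ (levT _ _ Tsc)) => /eqP.
  rewrite bc expr0n !mulr0 addr0 eq_sym; apply/negP.
  have -> : 2%:R * (T s i0 * T s c) + T c i0 * T s c ^+ 2
      = T s c * (2%:R * T s i0 + T s c * T c i0).
    by ring.
  by rewrite mulf_neq0 ?expf_neq0 // mulf_neq0.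
(* For [k < s] of level at least [m], both terms of [2 a_k = b_k - a_s T_sk] vanish. *)
right; exists s; split=> // [k mk ks|i k ik km]; last by rewrite bE // lt_s // lev_sE.
have [sk|] := ltnP s k; first exact: a_gt.
rewrite leq_eqVlt val_eqE (negPf ks) /= => lt_ks.
apply: (mulfI natr2_neq0); rewrite mulr0 aE // b0 //.
have [->|/levT] := eqVneq (T s k) 0; first by rewrite mulr0 subr0.
by rewrite lev_sE ltnNge mk.
Qed.

Definition level_triangular P := forall r k, (lev r < lev k)%N -> P r k = 0.

(** Row [r] of [S] only picks rows of [P] of lower level, which vanish above their own level. Hence
    row [r] of [S *m P] vanishes from level [lev r] on, and [square_multiple_level] applies with
    [m = lev r]. *)
Lemma row_levels S T P (r : 'I_n) : leveled S -> leveled T -> compatible S T P ->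
  (forall m, (lev m < lev r)%N -> forall k, (lev m < lev k)%N -> P m k = 0) ->
  (forall k, (lev r <= lev k)%N -> P r k = 0) \/
  exists s, [/\ lev s = lev r, P r s != 0,
    forall k, (lev r <= lev k)%N -> k != s -> P r k = 0 &
    forall i k, (i < k)%N -> (lev k < lev r)%N ->
      2%:R * ((S *m P) r i * (S *m P) r k) + T k i * (S *m P) r k ^+ 2
        = P r s ^+ 2 * (2%:R * (T s i * T s k) + T k i * T s k ^+ 2)].
Proof.
move=> [_ levS _] lT cP IH; apply: square_multiple_level (cP r) => // k rk.
rewrite mxE big1 // => m _.
have [->|/levS mr] := eqVneq (S r m) 0; first by rewrite mul0r.
by rewrite IH ?mulr0 // (leq_trans mr).
Qed.

(** Strong induction on the level, since [row_levels] only assumes the claim for rows of lower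
    level. This is the preservation of the spaces V_j. *)
Lemma compatible_triangular S T P : leveled S -> leveled T -> compatible S T P ->
  level_triangular P.
Proof.
move=> lS lT cP r; move: {2}(lev r).+1 (ltnSn (lev r)) => d.
elim: d r => // d IH r rd k rk.
have Pr m : (lev m < lev r)%N -> forall k, (lev m < lev k)%N -> P m k = 0.
  by move=> mr; apply: IH; apply: leq_trans mr _.
case: (row_levels lS lT cP Pr) => [a0|[s [sr _ a0 _]]]; first exact/a0/ltnW.
by apply: a0; [exact: ltnW | apply: contraTneq rk => ->; rewrite sr ltnn].
Qed.

Lemma mulmx_triangular P Q (r k s : 'I_n) : level_triangular Q ->
  (lev s <= lev k)%N -> (forall m, (lev s <= lev m)%N -> m != s -> P r m = 0) ->
  (P *m Q) r k = P r s * Q s k.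
Proof.
move=> tQ sk Pr; rewrite mxE (bigD1 s) //= big1 ?addr0 // => m ms.
have [sm|ms'] := leqP (lev s) (lev m); first by rewrite Pr // mul0r.
by rewrite tQ ?mulr0 // (leq_trans ms').
Qed.

Definition level_mu T (r : 'I_n) : nat :=
  #|[set k | ((lev k).+1 == lev r) && (T r k != 0)]|.

(** An element [i] of [A] outside [B] cannot have a partner in [A], so [A] is then a singleton and
    nonemptiness of [B] suffices. *)
Lemma card_le_of_pairs (A B : {set 'I_n}) : B != set0 ->
  (forall i k, i \in A -> k \in A -> i != k -> i \in B) -> (#|A| <= #|B|)%N.
Proof.
move=> B0 AB; have [/subset_leq_card//|/subsetPn[i iA iB]] := boolP (A \subset B).
have -> : A = [set i].
  apply/setP => k; rewrite inE; apply/idP/eqP => [kA|-> //].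
  by apply/eqP; apply: contraNT iB; rewrite eq_sym; apply: AB.
by rewrite cards1 card_gt0.
Qed.

(** [sigma r] is the column of the only nonzero entry of row [r] of [P] within its own level. *)
Lemma level_mu_perm S T P Q : leveled S -> leveled T ->
  P *m Q = 1%:M -> Q *m P = 1%:M -> compatible S T P -> compatible T S Q ->
  exists sigma : 'I_n -> 'I_n, [/\ injective sigma, forall r, lev (sigma r) = lev r &
    forall r, (0 < lev r)%N -> level_mu S r = level_mu T (sigma r)].
Proof.
move=> lS lT PQ QP cP cQ.
have tP := compatible_triangular lS lT cP; have tQ := compatible_triangular lT lS cQ.
have /fin_all_exists[sigma sigmaP] (r : 'I_n) : exists s, [/\ lev s = lev r, P r s != 0,
    forall k, (lev r <= lev k)%N -> k != s -> P r k = 0 &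
    forall i k, (i < k)%N -> (lev k < lev r)%N ->
      2%:R * ((S *m P) r i * (S *m P) r k) + T k i * (S *m P) r k ^+ 2
        = P r s ^+ 2 * (2%:R * (T s i * T s k) + T k i * T s k ^+ 2)].
  (* If row [r] of [P] stopped below its level, triangularity of [Q] would make the diagonal entry
     of [P *m Q] zero. *)
  have [a0|//] := row_levels lS lT cP (fun m _ k => tP m k) (r := r).
  have : (P *m Q) r r = 0.
    rewrite mxE big1 // => m _; have [/a0 ->|mr] := leqP (lev r) (lev m).
      by rewrite mul0r.
    by rewrite tQ ?mulr0.
  by rewrite PQ mxE eqxx => /eqP; rewrite oner_eq0.
have lev_sigma r : lev (sigma r) = lev r by case: (sigmaP r).
(* Within a level, an entry of [P *m Q = 1] is a single product. If [sigma r = sigma r'] with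
   [r != r'], entry [(r, r')] forces [Q (sigma r') r' = 0], against entry [(r', r')]. *)
have sigma_inj : injective sigma.
  move=> r r' rr'.
  have PQE q k : lev q = lev k -> (q == k)%:R = P q (sigma q) * Q (sigma q) k.
    move=> qk; have [_ _ P0 _] := sigmaP q.
    rewrite -(@mulmx_triangular P Q q k) ?PQ ?mxE // ?lev_sigma ?qk // => m.
    by rewrite -qk; apply: P0.
  have levE : lev r = lev r' by rewrite -lev_sigma rr' lev_sigma.
  have [//|/negPf nrr'] := eqVneq r r'.
  have := PQE r r' levE; rewrite nrr' => /esym/eqP; rewrite mulf_eq0.
  have [_ /negPf -> _ _] := sigmaP r; rewrite rr' => /eqP Q0.
  by have := PQE r' r' erefl; rewrite Q0 mulr0 eqxx => /eqP; rewrite oner_eq0.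
exists sigma; split=> // r r_gt0; set s := sigma r.
have [_ Prs0 _ sqE] := sigmaP r; have lev_s : lev s = lev r := lev_sigma r.
pose b := (S *m P) r.
(* Other rows [q] of the level of [m] have their nonzero entry at [sigma q], and rows of lower level
   do not reach [sigma m]. *)
have bE m : (lev m).+1 = lev r -> b (sigma m) = S r m * P m (sigma m).
  move=> mr; rewrite /b mxE (bigD1 m) //= big1 ?addr0 // => q qm.
  have [->|Srq] := eqVneq (S r q) 0; first by rewrite mul0r.
  have [_ levS _] := lS; have := levS _ _ Srq; rewrite -mr ltnS leq_eqVlt.
  case/orP => [/eqP qm'|qm']; last by rewrite tP ?mulr0 // lev_sigma.
  have [_ _ P0 _] := sigmaP q; rewrite P0 ?mulr0 ?lev_sigma ?qm' //.
  by rewrite (inj_eq sigma_inj) eq_sym.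
pose A := [set k | ((lev k).+1 == lev r) && (b k != 0)].
pose B := [set k | ((lev k).+1 == lev r) && (T s k != 0)].
have -> : level_mu S r = #|A|.
  rewrite /level_mu -(card_imset _ sigma_inj); congr #|pred_of_set _|.
  apply/setP => k; have [tau sK tK] := injF_bij sigma_inj; rewrite -(tK k).
  rewrite mem_imset // !inE lev_sigma; case: eqP => //= /bE ->.
  by rewrite mulf_eq0; have [_ /negPf -> _ _] := sigmaP (tau k); rewrite orbF.
have -> : level_mu T s = #|B| by rewrite /level_mu lev_s.
(* Two indices of the same level have [T k i = 0], so the square terms drop out and only a factor 2
   remains to be cancelled. *)
have bTE i k : (lev i).+1 = lev r -> (lev k).+1 = lev r -> i != k ->
    b i * b k = P r s ^+ 2 * (T s i * T s k).
  have wlog_lt i' k' : (lev i').+1 = lev r -> (lev k').+1 = lev r -> (i' < k')%N ->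
    b i' * b k' = P r s ^+ 2 * (T s i' * T s k').
    move=> ir kr /sqE; rewrite -kr ltnSn => /(_ isT).
    have -> : T k' i' = 0.
      have [_ levT _] := lT; apply/eqP; apply: contraTT isT => /levT.
      by rewrite -ltnS ir kr ltnn.
    rewrite !mul0r !addr0 -/b -/s => sqE'; apply: (mulfI natr2_neq0).
    by rewrite sqE'; ring.
  move=> ir kr; rewrite -val_eqE neq_ltn => /orP[|ki]; first exact: wlog_lt.
  by rewrite mulrC wlog_lt // [T s k * _]mulrC.
have neq0_of_leader M q : leveled M -> (0 < lev q)%N ->
    [set k | ((lev k).+1 == lev q) && (M q k != 0)] != set0.
  case=> _ _ levD /levD[c [i0 _ [cq Mqc _]]]; apply/set0Pn; exists c.
  by rewrite inE cq eqxx.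
apply/eqP; rewrite eqn_leq; apply/andP; split; apply: card_le_of_pairs.
- by rewrite /B -lev_s; apply: neq0_of_leader; rewrite // lev_s.
- move=> i k; rewrite !inE => /andP[/eqP ir bi] /andP[/eqP kr bk] ik.
  have : b i * b k != 0 by rewrite mulf_neq0.
  by rewrite bTE // ir eqxx !mulf_eq0 !negb_or => /and3P[].
- have /set0Pn[m] := neq0_of_leader S r lS r_gt0; rewrite inE => /andP[/eqP mr Srm].
  apply/set0Pn; exists (sigma m); rewrite inE lev_sigma mr eqxx bE // mulf_neq0 //.
  by case: (sigmaP m).
- move=> i k; rewrite !inE => /andP[/eqP ir Ti] /andP[/eqP kr Tk] ik.
  have : P r s ^+ 2 * (T s i * T s k) != 0 by rewrite !mulf_neq0 ?expf_neq0.
  by rewrite -bTE // ir eqxx mulf_eq0 negb_or => /andP[].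
Qed.
End Levels.

(** * From 1-based entries to ordinals *)

Section Entries.
Import GRing.Theory.
Context {F : fieldType} {n : nat}.
Implicit Types (T : 'M[F]_n) (i j k : 'I_n).

Lemma entryE T i k : entry T i.+1 k.+1 = T i k.
Proof.
rewrite /entry (bigD1 i) //= (bigD1 k) //= !big1 ?addr0 // => j /andP[/eqP[/val_inj ->]];
  by rewrite eqxx.
Qed.

Lemma entry_neq0 T i c : entry T i.+1 c != 0%R -> exists k : 'I_n, c = k.+1.
Proof.
rewrite /entry (bigD1 i) //= [X in (_ + X)%R]big1 ?addr0; last first.
  by move=> j /andP[/eqP[/val_inj ->]]; rewrite eqxx.
case: (pickP (fun b : 'I_n => b.+1 == c)) => [k /eqP <-|no_c]; first by exists k.
by rewrite big_pred0 ?eqxx.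
Qed.

Lemma succ_ord_index k : k.+1 \in index_iota 1 n.+1.
Proof. by rewrite mem_index_iota; exact: ltn_ord. Qed.

Lemma ltn_leader_col T i k : T i k != 0%R -> k < leader_col T i.+1.
Proof.
move=> Tik; rewrite /leader_col.
by apply: (@leq_bigmax_seq _ _ _ id k.+1); rewrite ?succ_ord_index ?entryE.
Qed.

Lemma leader_col_gt0 T i : 0 < leader_col T i.+1 ->
  exists2 k : 'I_n, leader_col T i.+1 = k.+1 & T i k != 0%R.
Proof.
suff [-> //|//] : leader_col T i.+1 = 0 \/
  exists2 k : 'I_n, leader_col T i.+1 = k.+1 & T i k != 0%R by [].
rewrite /leader_col; elim/big_ind: _ => [|x y Px Py|c Tic]; first by left.
  by rewrite /maxn; case: ifP.
by have [k ck] := entry_neq0 Tic; right; exists k => //; rewrite -entryE -ck.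
Qed.

Lemma nonzero_rowI T i k : T i k != 0%R -> nonzero_row T i.+1.
Proof. by move=> Tik; apply/hasP; exists k.+1; rewrite ?succ_ord_index ?entryE. Qed.

Lemma zero_row_prefix T i : zero_rows_on_top T -> nonzero_row T i.+1 ->
  count (fun r => ~~ nonzero_row T r) (index_iota 1 n.+1) <= i.
Proof.
move=> top nz_i; have sz : size (index_iota 1 i.+1) = i by rewrite size_iota subSS subn0.
rewrite -size_filter -sz; apply: uniq_leq_size => [|r]; first exact/filter_uniq/iota_uniq.
rewrite mem_filter !mem_index_iota => /andP[zr /andP[r_gt0 rn]].
by rewrite r_gt0; apply: (top r i.+1); rewrite ?r_gt0 //=; exact: ltn_ord.
Qed.

End Entries.

(** * The level function of a wall, and 2-REF matrices as leveled matrices *)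

Section WallLevels.
Context {F : fieldType} {n : nat}.
Implicit Types (T : 'M[F]_n) (w : seq nat).

Lemma min_chain_subseq (P : rel nat) r s : subseq (min_chain P r s) s.
Proof.
elim: s r => //= q s IH r; case: ifP => _; first by rewrite eqxx.
exact: subseq_trans (IH r) (subseq_cons _ _).
Qed.

(** This holds for every matrix, so it applies to [wall T] whichever representative [xget]
    returns. *)
Lemma wall_1REFP T : wall_1REF T = [:: 0] \/
  sorted ltn (wall_1REF T) /\ {in wall_1REF T, forall r, 0 < r <= n}.
Proof.
rewrite /wall_1REF.
case E: [seq r <- index_iota 1 n.+1 | nonzero_row T r] => [|r1 s]; [by left|right].
have : r1 \in index_iota 1 n.+1.
  have : r1 \in r1 :: s by rewrite mem_head.
  by rewrite -E mem_filter => /andP[].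
rewrite mem_index_iota => /andP[r1_gt0 r1_le].
have sub := min_chain_subseq (fun rj r => rj <= leader_col T r) r1 (index_iota r1.+1 n.+1).
rewrite /chain_from; split=> [|r].
  rewrite /= path_sortedE; last exact: ltn_trans.
  rewrite (subseq_sorted ltn_trans sub) ?iota_ltn_sorted // andbT.
  by apply/allP => r /(mem_subseq sub); rewrite mem_index_iota => /andP[].
rewrite inE => /predU1P[->|/(mem_subseq sub)]; first by rewrite r1_gt0.
by rewrite mem_index_iota ltnS => /andP[/(ltn_trans r1_gt0) -> ->].
Qed.

(** The entries at most [x] form a prefix of [s]; past the end, the default [d > x] keeps the
    equivalence true. *)
Lemma nth_le_count (s : seq nat) d x k : sorted ltn s -> x < d ->
  (nth d s k <= x) = (k < count (leq^~ x) s).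
Proof.
move=> s_sorted xd; elim: s s_sorted k => [|y s IH] /= s_sorted k.
  by rewrite nth_nil leqNgt xd.
case: (leqP y x) => yx; last first.
  rewrite (eq_in_count (a2 := pred0)) => [|z zs]; last first.
    have /(order_path_min ltn_trans)/allP/(_ _ zs) /= yz := s_sorted.
    by apply/negbTE; rewrite -ltnNge (ltn_trans yx).
  rewrite count_pred0; case: k => [|k] /=; first by rewrite leqNgt yx.
  rewrite IH ?(path_sorted s_sorted) //.
  rewrite (eq_in_count (a2 := pred0)) ?count_pred0 // => z zs.
  have /(order_path_min ltn_trans)/allP/(_ _ zs) /= yz := s_sorted.
  by apply/negbTE; rewrite -ltnNge (ltn_trans yx).
by case: k => [|k] //=; rewrite add1n IH ?(path_sorted s_sorted).
Qed.

Local Notation wall_nth := (@wall_nth n).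

(** The number of wall rows weakly above the 1-based row [i.+1], that is, the [j] with
    [r_j <= i.+1 < r_{j+1}]. *)
Definition wall_level w (i : 'I_n) : nat := count (leq^~ i.+1) w.

Lemma wall_level_le w (i k : 'I_n) : i <= k -> wall_level w i <= wall_level w k.
Proof. by move=> ik; apply: sub_count => r /= /leq_trans; apply; rewrite ltnS. Qed.

Lemma wall_levelE w (i : 'I_n) j : sorted ltn w ->
  (wall_nth w j <= i.+1) = (j <= wall_level w i).
Proof. by move=> w_sorted; case: j => // j; rewrite /wall_nth /= nth_le_count // ltnS. Qed.

Lemma wall_blockE w (i : 'I_n) j : sorted ltn w ->
  (wall_nth w j <= i.+1 < wall_nth w j.+1) = (wall_level w i == j).
Proof. by move=> ws; rewrite ltnNge !wall_levelE // -leqNgt eqn_leq andbC. Qed.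

Lemma wall_block_enum w j : sorted ltn w -> {in w, forall r, 0 < r <= n} ->
  index_iota (wall_nth w j) (wall_nth w j.+1)
    = [seq (i : 'I_n).+1 | i <- enum [pred i | wall_level w i == j]].
Proof.
move=> ws w_in.
have w1 k : 0 < wall_nth w k <= n.+1.
  case: k => // k; rewrite /wall_nth /=; have [kw|kw] := ltnP k (size w).
    by have /andP[-> /leqW] := w_in _ (mem_nth n.+1 kw).
  by rewrite nth_default ?leqnn.
apply: (irr_sorted_eq ltn_trans ltnn); first exact: iota_ltn_sorted.
  rewrite sorted_map /enum_mem; apply: sorted_filter.
    by move=> x y z /=; apply: ltn_trans.
  have := iota_ltn_sorted 0 n; rewrite -val_enum_ord sorted_map enumT.
  by apply: sub_sorted.
move=> r; rewrite mem_index_iota; apply/idP/mapP => [rj|[i]].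
  have r_gt0 : 0 < r by case/andP: rj => rj _; apply: leq_trans rj; case/andP: (w1 j).
  have rn : r.-1 < n.
    rewrite prednK //; case/andP: rj => _ /leq_trans h.
    by rewrite -ltnS h //; case/andP: (w1 j.+1).
  exists (Ordinal rn); last by rewrite /= prednK.
  by rewrite mem_enum inE -wall_blockE //= prednK.
by rewrite mem_enum inE -wall_blockE // => h ->.
Qed.

(** The columns of the interval are exactly the indices one level below row [i], by
    [wall_block_enum]. *)
Lemma row_mu_level T w (i : 'I_n) j : sorted ltn w -> {in w, forall r, 0 < r <= n} ->
  wall_level w i = j.+1 ->
  row_mu T (wall_nth w j) (wall_nth w j.+1) i.+1 = level_mu (wall_level w) T i.
Proof.
move=> ws w_in ij; rewrite /row_mu wall_block_enum // count_map /level_mu ij.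
rewrite (eq_count (a2 := fun k => T i k != 0%R)) => [|k /=]; last by rewrite entryE.
rewrite -size_filter cardE; congr size; rewrite {1}/enum_mem -filter_predI.
by apply: eq_filter => k; rewrite !inE eqSS andbC.
Qed.

Lemma is_2REF_sorted T : ~ slt_sim T 0%R -> is_2REF T ->
  sorted ltn (wall T) /\ {in wall T, forall r, 0 < r <= n}.
Proof.
move=> T_neq0 [T0|]; first by case: T_neq0; rewrite T0; apply: slt_sim_refl.
have [wT|//] : wall T = [:: 0] \/ sorted ltn (wall T) /\ {in wall T, forall r, 0 < r <= n}.
  exact: wall_1REFP.
(* The wall [[:: 0]] would make [r_1 = 0], but [r_1] is one more than the number of zero rows. *)
by rewrite /= wT; case=> _ [].

Qed.

Lemma is_2REF_leveled T : ~ slt_sim T 0%R -> is_2REF T ->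
  leveled (wall_level (wall T)) T.
Proof.
move=> T_neq0 REF; have [ws w_in] := is_2REF_sorted T_neq0 REF.
case: REF => [T0|]; first by case: T_neq0; rewrite T0; apply: slt_sim_refl.
move=> [_ [zeros top] [delta block] _].
have leaderP i j : wall_level (wall T) i = j.+1 ->
    wall_nth (wall T) j <= leader_col T i.+1 < wall_nth (wall T) j.+1.
  move=> ij; apply: (block j.+1); last by rewrite wall_blockE ?ij.
  by apply/andP; split; rewrite // -ij; apply: count_size.
split; first exact: wall_level_le.
- move=> i k Tik; case ij: (wall_level (wall T) i) => [|j].
    (* Level 0 means [i.+1 < r_1], so [i.+1] is at most the number of zero rows; a nonzero row there
       would have all of them strictly above it. *)
    have /eqP := ij; rewrite -wall_blockE // -zeros ltnS ltnNge.
    by rewrite (zero_row_prefix top (nonzero_rowI Tik)) andbF.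
  have /andP[_] := leaderP _ _ ij; rewrite ltnNge [_ < j.+1]ltnNge -(wall_levelE _ _ ws).
  by apply: contra => /leq_trans; apply; apply: ltn_leader_col.
- move=> i; case ij: (wall_level (wall T) i) => [//|j] _.
  have /andP[lo hi] := leaderP _ _ ij.
  (* Positivity excludes the conventional value 0 of [leader_col], so the leader column is a genuine
     index. *)
  have leader_gt0 : 0 < leader_col T i.+1.
    apply: leq_trans lo; case: j {ij hi} => // j; rewrite /Defs.wall_nth /=.
    have [jw|jw] := ltnP j (size (wall T)); last by rewrite nth_default.
    by have /andP[] := w_in _ (mem_nth n.+1 jw).
  have [c cE Tic] := leader_col_gt0 leader_gt0.
  have := delta i.+1 c.+1; case=> [|_ [i0 /andP[i0_gt0 i0c]]].
    by split; rewrite // ltn_ord.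
  have i0n : i0.-1 < n by rewrite prednK //; apply: leq_trans (ltnW i0c) (ltn_ord c).
  rewrite -(prednK i0_gt0) -[i0.-1]/(val (Ordinal i0n)) /Delta !entryE => D.
  exists c, (Ordinal i0n); first by rewrite /= prednK // -ltnS.
  by split=> //; congr _.+1; apply/eqP; rewrite -wall_blockE // -cE lo hi.
Qed.

End WallLevels.

(** * Comparison of the measure sequences *)

Lemma eq_min_chain (P Q : rel nat) r s : {in r :: s &, P =2 Q} ->
  min_chain P r s = min_chain Q r s.
Proof.
elim: s r => //= q s IH r PQ; rewrite -PQ ?inE ?eqxx ?orbT //.
by case: ifP => _; rewrite IH //; apply: sub_in2 PQ => x;
  rewrite !inE => /orP[] ->; rewrite ?orbT.
Qed.

Lemma sorted_map_index_iota (f : nat -> nat) a b :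
  (forall r, a <= r -> r.+1 < b -> f r <= f r.+1) ->
  sorted leq [seq f r | r <- index_iota a b].
Proof.
move=> f_le; apply/(sortedP 0) => i; rewrite size_map size_iota => ib.
rewrite !(nth_map 0) ?size_iota ?(ltnW ib) // !nth_iota ?(ltnW ib) // addnS.
by apply: f_le; rewrite ?leq_addr // -addnS -ltn_subRL.
Qed.

Theorem theorem3p46 (F : fieldType) (charF : 2%N \notin [pchar F]%R) (n : nat)
    (S T : 'M[F]_n) (w : seq nat) :
  is_sltm S -> is_sltm T ->
  ~ slt_sim S 0%R -> ~ slt_sim T 0%R ->
  is_2REF S -> is_2REF T ->
  wall S = w -> wall T = w ->
  slt_sim S T ->
  measure_seq S = measure_seq T.
Proof.
move=> sltS sltT S_neq0 T_neq0 REF_S REF_T wS wT simST.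
have [ws w_in] := is_2REF_sorted S_neq0 REF_S; rewrite wS in ws w_in.
have lS := is_2REF_leveled S_neq0 REF_S; rewrite wS in lS.
have lT := is_2REF_leveled T_neq0 REF_T; rewrite wT in lT.
have [P [Q [PQ QP] [cP cQ]]] := slt_sim_compatible sltS sltT simST.
have [sigma [sigma_inj lev_sigma mu_sigma]] := level_mu_perm charF lS lT PQ QP cP cQ.
have [tau _ sigmaK] := injF_bij sigma_inj.
pose rr := @wall_nth n w.
have mu_sorted (M : 'M[F]_n) j : M <> 0%R -> is_2REF M -> wall M = w -> 0 < j <= size w ->
    sorted leq [seq row_mu M (rr j.-1) (rr j) r | r <- index_iota (rr j) (rr j.+1)].
  move=> M0 [//|] + wM jw; rewrite /= wM => -[_ _ _ le_mu].
  by apply: sorted_map_index_iota => r lo hi; exact: (le_mu j r jw lo hi).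
have neq0 (M : 'M[F]_n) : ~ slt_sim M 0%R -> M <> 0%R.
  by move=> M0 ME; case: M0; rewrite ME; apply: slt_sim_refl.
(* Both lists of values are nondecreasing by condition (3) of 2-REF, and [sigma] permutes each
   block, so the lists are permutations of each other and hence equal row by row. *)
have mu_eq j : 0 < j <= size w -> {in index_iota (rr j) (rr j.+1),
    row_mu S (rr j.-1) (rr j) =1 row_mu T (rr j.-1) (rr j)}.
  move=> jw; apply/eq_in_map; apply: (sorted_eq leq_trans anti_leq);
    [exact/mu_sorted/jw/wS/REF_S/neq0|exact/mu_sorted/jw/wT/REF_T/neq0|].
  case: j jw => // j jw; rewrite wall_block_enum // -!map_comp.
  set E := enum _.
  have E_perm : perm_eq [seq sigma i | i <- E] E.
    apply: uniq_perm; rewrite ?(map_inj_uniq sigma_inj) ?enum_uniq // => i.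
    rewrite -(sigmaK i) (mem_map sigma_inj) !mem_enum !inE.
    by rewrite lev_sigma.
  apply: perm_trans (perm_map _ E_perm); rewrite -map_comp.
  apply/permP => p; congr (count p _); apply/eq_in_map => i.
  rewrite mem_enum inE => /eqP ij /=.
  by rewrite !(row_mu_level _ ws) ?lev_sigma // mu_sigma // ij.
rewrite /measure_seq wS wT; apply/eq_in_map => j; rewrite mem_iota add1n ltnS => jw.
(* Each block is nonempty, so its first row lies in the interval covered by [mu_eq]; for the last
   block the bound is the default [n.+1]. *)
have rr_lt : rr j < rr j.+1.
  case: j jw => // j /= jw; rewrite /rr /wall_nth /=.
  have [jw'|jw'] := ltnP j.+1 (size w).
    exact: (sorted_ltn_nth ltn_trans).
  by rewrite [nth _ _ j.+1]nth_default // ltnS; have /andP[] := w_in _ (mem_nth n.+1 jw).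
rewrite /measure_block wS wT -/rr.
have blockE : rr j :: index_iota (rr j).+1 (rr j.+1) = index_iota (rr j) (rr j.+1).
  by rewrite -[RHS]/(iota _ _) /index_iota -[in RHS](prednK (n := _ - rr j)) ?subn_gt0 //= subnS.
rewrite /chain_from (eq_min_chain
  (Q := fun r q => row_mu T (rr j.-1) (rr j) r < row_mu T (rr j.-1) (rr j) q)).
  apply/eq_in_map => r r_in; rewrite mu_eq // -blockE.
  move: r_in; rewrite !inE => /predU1P[->|]; first by rewrite eqxx.
  by move=> /(mem_subseq (min_chain_subseq _ _ _)) ->; rewrite orbT.
by rewrite blockE => r q r_in q_in /=; rewrite !mu_eq.
Qed.
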